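(* Let $\mathcal{G}$ be a DAG on node set $[p]$ and assume that the distinct nodes $i$ and $j$ are not adjacent in the skeleton of $\mathcal{G}$. If $\mathcal{G}_{+i\leftarrow j}$ is a DAG, then $\{\mathcal{G},\mathcal{G}_{+i\leftarrow j}\}$ is an edge pair.
   Context: All graphs are simple and $[p]=\{1,\dots,p\}$. A DAG is a directed acyclic graph. The skeleton of a directed graph is the undirected graph obtained by forgetting the directions of the edges. For a DAG $\mathcal{G}$ let $\operatorname{pa}_{\mathcal{G}}(i)=\{k\colon k\to i\in\mathcal{G}\}$. If $i$ and $j$ are not adjacent in the skeleton of $\mathcal{G}$, then $\mathcal{G}_{+i\leftarrow j}$ denotes the directed graph obtained from $\mathcal{G}$ by adding the edge $i\leftarrow j$. Characteristic imset: for a DAG $\mathcal{G}$ on $[p]$, $c_{\mathcal{G}}\colon\{S\subseteq[p]\colon|S|\ge 2\}\to\{0,1\}$ is given by $c_{\mathcal{G}}(S)=1$ if there exists $i\in S$ such that $j\in\operatorname{pa}_{\mathcal{G}}(i)$ for all $j\in S\setminus\{i\}$, and $c_{\mathcal{G}}(S)=0$ otherwise. It is identified with a vector in $\mathbb{R}^{2^p-p-1}$ with standard basis vectors $e_S$ indexed by the sets $S\subseteq[p]$, $|S|\geq 2$. Edge pair: let $\mathcal{G}$ and $\mathcal{H}$ be two DAGs on node set $[p]$. Suppose there exist distinct nodes $i$, $j$ and a set $S^\ast\subseteq[p]\setminus\{i,j\}$ such that (1) $c_{\mathcal{G}}(\{i,j\})=0$; (2) $c_{\mathcal{G}}(S\cup\{i\})=1$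 for all $S\subseteq S^\ast$ with $|S|\ge1$. Then $\{\mathcal{G},\mathcal{H}\}$ is an edge pair (with respect to $(i,j,S^\ast)$) if $$c_{\mathcal{H}}=c_{\mathcal{G}}+\sum_{S\in\mathcal{S}_{+i\leftarrow j}}e_S,\qquad\text{where } \mathcal{S}_{+i\leftarrow j}=\{S\cup\{i,j\}\colon S\subseteq S^\ast\}.$$ *)

(* Defs.v *)
From HB Require Import structures.
From mathcomp Require Import all_boot all_order all_algebra.
From mathcomp Require Import reals.

Set Implicit Arguments.
Unset Strict Implicit.
Unset Printing Implicit Defensive.
Import Order.TTheory GRing.Theory Num.Theory.
Local Open Scope ring_scope.

(* A directed graph on the p nodes 'I_p is a relation G, where G a b means
   a -> b.  Acyclicity also rules out loops and pairs of opposite arcs (cycles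
   of length 1 and 2), so a DAG in this sense is a simple graph. *)
Definition is_dag (p : nat) (G : rel 'I_p) : Prop :=
  forall c : seq 'I_p, ucycle G c -> c = [::].

Definition skeleton (p : nat) (G : rel 'I_p) : rel 'I_p :=
  [rel a b | G a b || G b a].

Definition pa (p : nat) (G : rel 'I_p) (i : 'I_p) : {set 'I_p} :=
  [set k | G k i].

(* The graph G_{+ i <- j}: the new arc goes from j to i. *)
Definition add_arc (p : nat) (G : rel 'I_p) (i j : 'I_p) : rel 'I_p :=
  [rel a b | G a b || (a == j) && (b == i)].

(* The value c_G(S), as 0 or 1.  It is total on sets of nodes but only
   meaningful when #|S| >= 2. *)
Definition imset_val (p : nat) (G : rel 'I_p) (S : {set 'I_p}) : nat :=
  [exists i in S, [forall j in S :\ i, j \in pa G i]].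

Definition imset_index (p : nat) : finType :=
  {S : {set 'I_p} | (2 <= #|S|)%N}.

Notation imset_space R p := {ffun imset_index p -> R}.

Definition char_imset (R : realType) (p : nat) (G : rel 'I_p) :
    imset_space R p :=
  [ffun S : imset_index p => (imset_val G (val S))%:R].

Definition std_basis (R : realType) (p : nat) (S : imset_index p) :
    imset_space R p :=
  [ffun T : imset_index p => (T == S)%:R].

Definition added_sets (p : nat) (i j : 'I_p) (Sstar : {set 'I_p}) :
    {set {set 'I_p}} :=
  [set S :|: [set i; j] | S in powerset Sstar].

(* When i != j every member of added_sets has at least two elements, so the sum
   below, over the coordinates whose set is in added_sets, omits none of them.
   The arguments of is_edge_pair are ordered: G has the smaller imset. *)
Definition is_edge_pair_wrt (R : realType) (p : nat) (G H : rel 'I_p)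
    (i j : 'I_p) (Sstar : {set 'I_p}) : Prop :=
  [/\ i != j,
      Sstar \subset ~: [set i; j],
      imset_val G [set i; j] = 0%N,
      forall S : {set 'I_p}, S \subset Sstar -> (1 <= #|S|)%N ->
        imset_val G (S :|: [set i]) = 1%N
    & char_imset R H = char_imset R G
        + \sum_(S : imset_index p | val S \in added_sets i j Sstar)
            std_basis R S].

Definition is_edge_pair (R : realType) (p : nat) (G H : rel 'I_p) : Prop :=
  [/\ is_dag G, is_dag H
    & exists (i j : 'I_p) (Sstar : {set 'I_p}),
        is_edge_pair_wrt R G H i j Sstar].

(* Main.v *)
Require Import Defs.
From mathcomp Require Import all_boot all_order all_algebra.
From mathcomp Require Import reals.

(** Take [Sstar] to be the parents of [i] in [G].  Adding the arc [j -> i]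
    changes the parents of [i] only, so a set [T] that acquires a vertex whose
    parents include the rest of [T] must acquire [i] as such a vertex and
    contain [j]: it is [S :|: [set i; j]] with [S] included in the parents of
    [i].  No such set had this property in [G]: the vertex could be neither [i]
    nor [j], which are not adjacent, and if it was a parent of [i], having [i]
    as a parent would close a 2-cycle. *)

Import GRing.Theory.
Local Open Scope ring_scope.

Lemma dag_irreflexive (p : nat) (G : rel 'I_p) : is_dag G -> irreflexive G.
Proof.
move=> dagG x; apply/negP => Gxx.
by have /(_ _)/eqP := dagG [:: x]; rewrite /ucycle /= Gxx => /(_ isT).
Qed.

Lemma dag_asymmetric (p : nat) (G : rel 'I_p) (x y : 'I_p) :
  is_dag G -> G x y -> ~~ G y x.
Proof.
move=> dagG Gxy; apply/negP => Gyx.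
(* [ucycle] demands a repetition-free sequence, so the case of a loop is excluded first. *)
have nxy : x != y.
  by apply/eqP => exy; move: Gxy; rewrite exy dag_irreflexive.
have /(_ _)/eqP := dagG [:: x; y].
by rewrite /ucycle /= Gxy Gyx inE nxy => /(_ isT).
Qed.

Lemma imset_valE (p : nat) (G : rel 'I_p) (T : {set 'I_p}) :
  imset_val G T = [exists k in T, T :\ k \subset pa G k].
Proof.
congr nat_of_bool; apply: eq_existsb => k; congr (_ && _).
by apply/forall_inP/subsetP.
Qed.

Lemma pa_add_arc (p : nat) (G : rel 'I_p) (i j k : 'I_p) :
  pa (add_arc G i j) k = if k == i then j |: pa G i else pa G k.
Proof.
apply/setP => x; case: eqVneq => [->|/negPf nki]; rewrite !inE /add_arc /=.
  by rewrite eqxx andbT orbC.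
by rewrite nki andbF orbF.
Qed.

(** For [S = pa G i], the inclusion on the right says that in [add_arc G i j] all of [T :\ i] are
    parents of [i]. *)
Lemma mem_added_sets (p : nat) (i j : 'I_p) (S T : {set 'I_p}) :
  (T \in added_sets i j S) = [&& i \in T, j \in T & T :\ i \subset j |: S].
Proof.
apply/imsetP/and3P => [[U]|[iT jT /subsetP sT]].
  rewrite inE => /subsetP sUS ->; split; rewrite ?inE ?eqxx ?orbT //.
  apply/subsetP => x; rewrite !inE => /andP[/negPf->].
  by case/orP => [/sUS|/= ->//] ->; rewrite orbT.
exists (T :\: [set i; j]).
  rewrite inE; apply/subsetP => x; rewrite !inE negb_or.
  move=> /andP[/andP[xi xj] xT].
  by have := sT x; rewrite !inE xi xT (negPf xj) => /(_ isT).
apply/setP => x; rewrite !inE.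
by case: eqVneq => [->|_] /=; [|case: eqVneq => [->|_] /=]; rewrite ?orbT ?orbF.
Qed.

Section AddArc.

Variables (p : nat) (G : rel 'I_p) (i j : 'I_p).
Hypotheses (dagG : is_dag G) (neq_ij : i != j) (nadj : ~~ skeleton G i j).

Lemma pa_subC : pa G i \subset ~: [set i; j].
Proof.
apply/subsetP => x; rewrite !inE negb_or => Gxi; apply/andP; split.
  by apply: contraTneq Gxi => ->; rewrite dag_irreflexive.
by apply: contraTneq Gxi => ->; move: nadj; rewrite /= negb_or => /andP[].
Qed.

Lemma imset_val_added (T : {set 'I_p}) :
  T \in added_sets i j (pa G i) -> imset_val G T = 0%N.
Proof.
rewrite mem_added_sets => /and3P[iT jT /subsetP sT].
move: nadj; rewrite /= negb_or => /andP[nGij nGji].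
rewrite imset_valE; case: exists_inP => // -[k kT /subsetP sTk].
(* Any such [k] other than [i] is a child of [i]; this refutes both [k = j] and [k] a parent of
   [i]. *)
have Gik : k != i -> G i k.
  by move=> ki; have := sTk i; rewrite !inE eq_sym ki iT; apply.
have [ki|ki] := eqVneq k i.
  have := sTk j; rewrite !inE ki eq_sym neq_ij jT (negPf nGji).
  by move=> /(_ isT).
have [kj|kj] := eqVneq k j; first by move: (Gik ki); rewrite kj (negPf nGij).
have := sT k; rewrite !inE ki kT (negPf kj) => /(_ isT) Gki.
by have := dag_asymmetric _ _ _ _ dagG Gki; rewrite Gik.
Qed.

Lemma imset_val_add_arc (T : {set 'I_p}) :
  imset_val (add_arc G i j) T
    = (imset_val G T + (T \in added_sets i j (pa G i)))%N.
Proof.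
have [Tadd|] := boolP (T \in _).
  (* The old value is 0, and [i] witnesses the new value 1. *)
  rewrite imset_val_added // imset_valE.
  move: Tadd; rewrite mem_added_sets => /and3P[iT _ sT].
  by case: exists_inP => // -[]; exists i; rewrite // pa_add_arc eqxx.
rewrite mem_added_sets addn0 !imset_valE => nTadd.
(* The two conditions agree vertex by vertex; only [k = i] needs an argument. *)
congr nat_of_bool; apply: eq_existsb => k; rewrite pa_add_arc.
case: eqVneq => // ->; case iT: (i \in T) => //=.
(* If [j] is in [T], even the larger set [j |: pa G i] fails to contain [T :\ i], so both sides are
   false; otherwise the extra element [j] changes nothing. *)
move: nTadd; rewrite iT /=; have [jT /= /negPf sT|jT _] := boolP (j \in T).
  rewrite sT; apply/esym/negbTE; apply: contraFN sT => sT.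
  exact: subset_trans sT (subsetUr _ _).
apply/subsetP/subsetP => sT x xTi; last by rewrite inE sT ?orbT.
move: (sT x xTi); rewrite in_setU1 => /orP[/eqP xj|//].
by move: xTi; rewrite xj in_setD1 (negPf jT) andbF.
Qed.

End AddArc.

(** Only the term [S = T] can be nonzero at the coordinate [T]. *)
Lemma sum_std_basisE (R : realType) (p : nat) (A : pred (imset_index p))
    (T : imset_index p) :
  (\sum_(S | A S) std_basis R S) T = (A T)%:R.
Proof.
rewrite sum_ffunE big_mkcond (bigD1 T) //= big1 => [|S neqST].
  by rewrite ffunE eqxx addr0; case: (A T).
by rewrite ffunE eq_sym (negPf neqST) if_same.
Qed.

Theorem proposition3p7 (R : realType) (p : nat) (G : rel 'I_p) (i j : 'I_p) :
  is_dag G -> i != j -> ~~ skeleton G i j -> is_dag (add_arc G i j) ->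
  is_edge_pair R G (add_arc G i j).
Proof.
move=> dagG neq_ij nadj dagH; split=> //; exists i, j, (pa G i); split=> //.
- exact: pa_subC.
- apply: (imset_val_added _ _ i j) => //.
  (* The pair [[set i; j]] is itself an added set, coming from the empty set of parents. *)
  by apply/imsetP; exists set0; rewrite ?set0U // inE sub0set.
- move=> S sS _; rewrite imset_valE; case: exists_inP => // -[].
  exists i; first by rewrite !inE eqxx orbT.
  by rewrite setDUl setDv setU0 (subset_trans (subsetDl _ _)).
apply/ffunP => T; rewrite [RHS]ffunE sum_std_basisE !ffunE.
by rewrite imset_val_add_arc // natrD.
Qed.
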